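(* Let $\phi\in S^d\mathbb C^n$ with $\langle\phi\rangle=\mathbb C^n$ and let $1\le s\le d$. With the convention $\dim\emptyset=-1$, $$R(\phi)\ \ge\ \operatorname{rank}\phi_{s,d-s}+\dim\Sigma_s(\phi)+1.$$
   Context: $S^d\mathbb C^n$ denotes the space of complex homogeneous polynomials of degree $d$ in $n$ variables, regarded as functions on $\mathbb C^{n*}$. The rank $R(\phi)$ is the smallest $r$ such that $\phi=\ell_1^d+\cdots+\ell_r^d$ with $\ell_j\in\mathbb C^n$. The span of $\phi$ is $\langle\phi\rangle=\{\alpha\in\mathbb C^{n*}\mid \partial\phi/\partial\alpha=0\}^\perp\subseteq\mathbb C^n$; thus $\langle\phi\rangle=\mathbb C^n$ means that $\phi$ cannot be written in fewer than $n$ variables after a linear change of coordinates. Let $\tilde\phi$ be the polarization of $\phi$, i.e. the symmetric $d$-linear form with $\tilde\phi(x,\dots,x)=\phi(x)$; $\phi_{s,d-s}:S^s\mathbb C^{n*}\to S^{d-s}\mathbb C^n$ is the linear map with $\phi_{s,d-s}(x_1\cdots x_s)(y_1\cdots y_{d-s})=\tilde\phi(x_1,\dots,x_s,y_1,\dots,y_{d-s})$. With $\mathrm{Zeros}(\phi)=\{[x]\in\mathbb P\mathbb C^{n*}\mid\phi(x)=0\}$ and linear coordinates $x_1,\dots,x_n$ on $\mathbb C^{n*}$, $$\Sigma_s(\phi)=\Big\{[x]\in\mathrm{Zeros}(\phi)\ \Big|\ \tfrac{\partial^I\phi}{\partial x^I}(x)=0\ \text{ for all multi-indices } |I|\le s\Big\}\subset\mathbb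 P\mathbb C^{n*};$$ its dimension is its dimension as a projective variety. *)

(* Defs.v *)
From HB Require Import structures.
(* multinomials has to be imported before mathcomp-analysis: in the other order
   their notation levels clash. *)
From mathcomp Require Import all_boot all_order all_algebra complex mpoly.
From mathcomp Require ssrcomplements.
From mathcomp Require Import boolp classical_sets reals constructive_ereal ereal.

Set Implicit Arguments.
Unset Strict Implicit.
Unset Printing Implicit Defensive.

Import Order.TTheory GRing.Theory Num.Theory.

Local Open Scope classical_set_scope.
Local Open Scope ring_scope.

(* Coordinates: C^n and its dual C^{n*} are both 'rV[K]_n, paired by
   (a, v) |-> \sum_i a 0 i * v 0 i.  An element v of C^n is identified with the
   linear form linform v, and S^d C^n with the forms of degree d in 'X_0, ...,
   'X_(n-1); S^s C^{n*} is likewise the space of forms of degree s. *)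

(* multinomials only makes dhomog n K d a vectType when n is a successor; this
   alias carries the structure for every n. *)
Definition SymPow (K : fieldType) (n d : nat) : Type := dhomog n K d.

HB.instance Definition _ (K : fieldType) (n d : nat) :=
  SubType.copy (SymPow K n d) (dhomog n K d).
HB.instance Definition _ (K : fieldType) (n d : nat) :=
  GRing.Lmodule.copy (SymPow K n d) (dhomog n K d).

Definition form_poly (K : fieldType) (n d : nat) (p : SymPow K n d) :
    {mpoly K[n]} :=
  mpoly_of_dhomog p.
Coercion form_poly : SymPow >-> mpoly.

Lemma SymPow_homog (K : fieldType) (n d : nat) (p : SymPow K n d) :
  (p : {mpoly K[n]}) \is d.-homog.
Proof. exact: dhomog_is_dhomog. Qed.

Lemma form_poly_is_linear (K : fieldType) (n d : nat) :
  linear (@form_poly K n d).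
Proof. by move=> c p q; rewrite /form_poly linearP. Qed.

HB.instance Definition _ (K : fieldType) (n d : nat) :=
  GRing.isLinear.Build K (SymPow K n d) {mpoly K[n]} _ (@form_poly K n d)
    (@form_poly_is_linear K n d).

Lemma form_poly_inj (K : fieldType) (n d : nat) : injective (@form_poly K n d).
Proof. by move=> p q e; exact: val_inj. Qed.

Local Notation monos n d := {m : 'X_{1..n < d.+1} | mdeg m == d}.

Lemma SymPow_vecaxiom (K : fieldType) (n d : nat) :
  Vector.axiom #|{: monos n d}| (SymPow K n d).
Proof.
pose f (p : SymPow K n d) := \row_(i < #|{: monos n d}|)
  (p : {mpoly K[n]})@_(val (val (enum_val i))).
exists f => [c p q|].
  by apply/rowP=> i; rewrite !mxE (linearP (@form_poly K n d)) mcoeffD mcoeffZ.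
pose g (r : 'rV[K]_#|{: monos n d}|) : {mpoly K[n]} :=
  \sum_(m : monos n d) r 0 (enum_rank m) *: 'X_[val (val m)].
have dg r : g r \is d.-homog.
  rewrite rpred_sum //= => m _; apply/rpredZ.
  by rewrite dhomogX (valP m).
have co r (m : monos n d) : (g r)@_(val (val m)) = r 0 (enum_rank m).
  rewrite raddf_sum (bigD1 m) //= mcoeffZ mcoeffX eqxx mulr1 big1 ?addr0 //.
  move=> m' ne; rewrite mcoeffZ mcoeffX.
  by rewrite (_ : (_ == _) = false) ?mulr0 //; apply/negbTE; rewrite !val_eqE.
exists (fun r => DHomog (dg r) : SymPow K n d) => [p|r]; last first.
  by apply/rowP=> i; rewrite mxE /form_poly /= co enum_valK.
apply: form_poly_inj; apply/mpolyP=> m; rewrite /form_poly /= -/(form_poly p).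
have [dm|/eqP dm] := mdeg m =P d; last first.
  by rewrite (dhomog_nemf_coeff (dg _) dm)
             (dhomog_nemf_coeff (SymPow_homog p) dm).
have lm : (mdeg m < d.+1)%N by rewrite dm.
have /eqP dm' := dm.
pose mm : monos n d := exist _ (BMultinom lm) dm'.
by rewrite (co _ mm) mxE enum_rankK.
Qed.

HB.instance Definition _ (K : fieldType) (n d : nat) :=
  Lmodule_hasFinDim.Build K (SymPow K n d) (@SymPow_vecaxiom K n d).

Section Forms.
Context {K : fieldType} {n : nat}.
Implicit Types (p q : {mpoly K[n]}) (v x a : 'rV[K]_n).

Definition linform v : {mpoly K[n]} := \sum_(i < n) v 0 i *: 'X_i.

Definition dirderiv a p : {mpoly K[n]} := \sum_(i < n) a 0 i *: p^`M(i).

Definition form_span (d : nat) (phi : SymPow K n d) : set 'rV[K]_n :=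
  [set v | forall a, dirderiv a phi = 0 -> \sum_(i < n) a 0 i * v 0 i = 0].

(* The polarization, in characteristic 0, by full differentiation: for d
   vectors xs the iterated derivative is a constant.  See polar_perm,
   polar_multilinear and polar_diag below. *)
Definition polar (d : nat) (phi : SymPow K n d) (xs : seq 'rV[K]_n) : K :=
  (d`!%:R)^-1 * (foldr dirderiv phi xs)@_0%MM.

(* p(d/dX_0, ..., d/dX_(n-1)) q *)
Definition contract q p : {mpoly K[n]} :=
  \sum_(m <- msupp p) p@_m *: q^`M[m].

Lemma dirderiv_is_linear a : linear (dirderiv a).
Proof.
move=> c p q; rewrite /dirderiv scaler_sumr -big_split /=.
by apply: eq_bigr => i _; rewrite linearP scalerDr !scalerA mulrC.
Qed.

HB.instance Definition _ a :=
  GRing.isLinear.Build K {mpoly K[n]} {mpoly K[n]} _ (dirderiv a)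
    (dirderiv_is_linear a).

Lemma dirderiv_linear_l c a v p :
  dirderiv (c *: a + v) p = c *: dirderiv a p + dirderiv v p.
Proof.
rewrite /dirderiv scaler_sumr -big_split /=; apply: eq_bigr => i _.
by rewrite !mxE scalerDl scalerA.
Qed.

Lemma dirderivC a v p : dirderiv a (dirderiv v p) = dirderiv v (dirderiv a p).
Proof.
have E b c : dirderiv b (dirderiv c p) =
    \sum_i \sum_j b 0 i *: (c 0 j *: p^`M(j)^`M(i)).
  apply: eq_bigr => i _; rewrite /dirderiv (linear_sum (mderiv i)) scaler_sumr.
  by apply: eq_bigr => j _; rewrite /= mderivZ.
rewrite !E exchange_big; apply: eq_bigr => i _; apply: eq_bigr => j _.
by rewrite !scalerA mulrC mderiv_comm.
Qed.

Lemma dirderiv_mono a (m : 'X_{1..n}) :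
  dirderiv a 'X_[m] = \sum_(i < n) (a 0 i * (m i)%:R) *: 'X_[m - U_(i)].
Proof. by apply: eq_bigr => i _; rewrite mderivX scalerA. Qed.

Lemma dirderiv_homog a d p : p \is d.-homog -> dirderiv a p \is d.-1.-homog.
Proof.
move=> hp; rewrite (mpolyE p) linear_sum /= big_seq rpred_sum // => m mp.
rewrite linearZ /= rpredZ // dirderiv_mono rpred_sum // => i _.
have [->|mi] := eqVneq (m i) 0%N; first by rewrite mulr0 scale0r rpred0.
rewrite rpredZ // dhomogX /= -(dhomog_mf hp mp) /=.
have le : (U_(i) <= m)%MM by rewrite lep1mP.
by rewrite -{2}(submK le) mdegD mdeg1 addn1.
Qed.

Lemma foldr_dirderiv_homog xs d p : p \is d.-homog ->
  foldr dirderiv p xs \is (d - size xs).-homog.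
Proof.
move=> hp; elim: xs => [|x xs IH] /=; first by rewrite subn0.
by rewrite subnS dirderiv_homog.
Qed.

Lemma euler x d p : p \is d.-homog ->
  (dirderiv x p).@[x 0] = d%:R * p.@[x 0].
Proof.
move=> hp; rewrite (mpolyE p) (linear_sum (dirderiv x)) /=.
rewrite !(raddf_sum (meval _)) /= mulr_sumr.
rewrite big_seq [RHS]big_seq; apply: eq_bigr => m mp.
rewrite linearZ /= !mevalZ mulrCA; congr (_ * _).
rewrite dirderiv_mono raddf_sum /= -(dhomog_mf hp mp) /= mdegE.
rewrite natr_sum mulr_suml.
apply: eq_bigr => i _; rewrite mevalZ.
have [->|mi] := eqVneq (m i) 0%N; first by rewrite mulr0 !mul0r.
have le : (U_(i) <= m)%MM by rewrite lep1mP.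
have {4}-> : m = (m - U_(i) + U_(i))%MM by rewrite submK.
rewrite mpolyXD mevalM mevalXU.
by rewrite [x 0 i * _]mulrC -mulrA [x 0 i * _]mulrC.
Qed.

Lemma foldr_dirderiv_linear xs : linear (fun p => foldr dirderiv p xs).
Proof. by move=> c p q; elim: xs => //= x xs ->; rewrite linearP. Qed.

Lemma foldr_dirderiv_perm p xs ys :
  perm_eq xs ys -> foldr dirderiv p xs = foldr dirderiv p ys.
Proof.
have mv x us vs : foldr dirderiv p (us ++ x :: vs) =
    dirderiv x (foldr dirderiv p (us ++ vs)).
  by elim: us => //= u us ->; rewrite dirderivC.
elim: xs ys => [|x xs IH] ys; first by move/perm_size/esym/size0nil ->.
move=> pe; have xys : x \in ys by rewrite -(perm_mem pe) mem_head.
case/splitPr: xys pe => us vs pe; rewrite mv /= (IH (us ++ vs)) //.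
by rewrite -(perm_cons x) (perm_trans pe) // perm_catC /= perm_cons perm_catC.
Qed.

Lemma polar_perm d (phi : SymPow K n d) xs ys :
  perm_eq xs ys -> polar phi xs = polar phi ys.
Proof. by move=> pe; rewrite /polar (foldr_dirderiv_perm _ pe). Qed.

Lemma polar_multilinear d (phi : SymPow K n d) c a v xs :
  polar phi (c *: a + v :: xs) = c * polar phi (a :: xs) + polar phi (v :: xs).
Proof.
by rewrite /polar /= dirderiv_linear_l mcoeffD mcoeffZ mulrDr mulrCA.
Qed.

Lemma contractwE k p q : (msize p <= k)%N ->
  contract q p = \sum_(m : 'X_{1..n < k}) p@_m *: q^`M[m].
Proof.
move=> lt_pk; rewrite /contract.
rewrite (ssrcomplements.big_mksub 'X_{1..n < k}) //=; first last.
- by move=> x /msize_mdeg_lt/leq_trans/(_ lt_pk) ->.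
- by rewrite msupp_uniq.
rewrite big_rmcond //= => i.
by move/memN_msupp_eq0 ->; rewrite scale0r.
Qed.

Lemma contract_linear_l q : linear (contract q).
Proof.
move=> c p1 p2.
pose k := maxn (msize (c *: p1 + p2)) (maxn (msize p1) (msize p2)).
rewrite !(@contractwE k) ?leq_max ?leqnn ?orbT //.
rewrite scaler_sumr -big_split /=; apply: eq_bigr => m _.
by rewrite mcoeffD mcoeffZ scalerDl scalerA.
Qed.

HB.instance Definition _ q :=
  GRing.isLinear.Build K {mpoly K[n]} {mpoly K[n]} _ (contract q)
    (contract_linear_l q).

Lemma contractX (m : 'X_{1..n}) q : contract q 'X_[m] = q^`M[m].
Proof. by rewrite /contract msuppX big_seq1 mcoeffX eqxx scale1r. Qed.

Lemma contract1 q : contract q 1 = q.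
Proof. by rewrite -mpolyX0 contractX mderivm0m. Qed.

Lemma contract_linform x p q :
  contract q (linform x * p) = dirderiv x (contract q p).
Proof.
rewrite (mpolyE p) mulr_sumr.
rewrite (linear_sum (contract q)) /= (linear_sum (contract q)) /= linear_sum /=.
apply: eq_bigr => m _.
rewrite -scalerAr !(linearZ_LR (contract q)) /= linearZ /=; congr (_ *: _).
rewrite /linform mulr_suml (linear_sum (contract q)) /=.
apply: eq_bigr => i _.
rewrite -scalerAl (linearZ_LR (contract q)) /= -mpolyXD !contractX.
by rewrite addmC mderivmDm mderivmU1m.
Qed.

Lemma contract_prod xs q :
  contract q (\prod_(x <- xs) linform x) = foldr dirderiv q xs.
Proof.
elim: xs => [|x xs IH]; first by rewrite big_nil contract1.
by rewrite big_cons contract_linform IH.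
Qed.

Lemma contract_homog s d p q : p \is s.-homog -> q \is d.-homog ->
  contract q p \is (d - s).-homog.
Proof.
move=> hp hq; rewrite /contract big_seq rpred_sum // => m mp; apply: rpredZ.
rewrite -(dhomog_mf hp mp) mderivm_foldr /= mdegE.
have hs i : foldr (@mderiv _ _) q i \is (d - size i).-homog.
  elim: i => [|i t IH] /=; first by rewrite subn0.
  suff -> r : r^`M(i) = dirderiv (delta_mx 0 i) r
    by rewrite subnS dirderiv_homog.
  rewrite /dirderiv (bigD1 i) //= mxE !eqxx scale1r big1 ?addr0 // => j ne.
  by rewrite mxE (negbTE ne) andbF scale0r.
set t := flatten _; suff -> : (\sum_(i < n) m i)%N = size t by exact: hs.
rewrite size_flatten /shape sumnE !big_map /=.
by rewrite /index_enum -enumT; apply: eq_bigr => i _; rewrite size_nseq.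
Qed.

(* phi_{s,d-s}: the image of a product x_1 ... x_s is the iterated derivative
   of phi along x_1, ..., x_s up to the factor (d-s)!/d!.  The lemma
   flatteningE below is the defining property. *)
Definition flattening_fun (d : nat) (phi : SymPow K n d) (s : nat)
    (p : SymPow K n s) : SymPow K n (d - s) :=
  ((d - s)`!%:R / d`!%:R : K)
    *: (DHomog (contract_homog (SymPow_homog p) (SymPow_homog phi))
        : SymPow K n (d - s)).

Lemma flattening_fun_is_linear d (phi : SymPow K n d) s :
  linear (@flattening_fun d phi s).
Proof.
move=> c p q; apply: form_poly_inj; rewrite linearP !linearZ /=.
rewrite /form_poly /= -/(form_poly p) -/(form_poly q).
by rewrite (linearP (contract _)) /= scalerDr !scalerA mulrC.
Qed.

HB.instance Definition _ d (phi : SymPow K n d) s :=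
  GRing.isLinear.Build K (SymPow K n s) (SymPow K n (d - s)) _
    (@flattening_fun d phi s) (@flattening_fun_is_linear d phi s).

Definition flattening (d : nat) (phi : SymPow K n d) (s : nat) :
    'Hom(SymPow K n s, SymPow K n (d - s)) :=
  linfun (@flattening_fun d phi s).

Definition waring_decomposable (d : nat) (phi : SymPow K n d) (r : nat) :
    Prop :=
  exists l : 'I_r -> 'rV[K]_n,
    (phi : {mpoly K[n]}) = \sum_(j < r) linform (l j) ^+ d.

End Forms.

Section CharacteristicZero.
Context {K : numFieldType} {n : nat}.

Lemma polar_diag (d : nat) (phi : SymPow K n d) (x : 'rV[K]_n) :
  polar phi (nseq d x) = (phi : {mpoly K[n]}).@[x 0].
Proof.
have ev k : (k <= d)%N -> (foldr dirderiv phi (nseq k x)).@[x 0] =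
    (d ^_ k)%:R * (phi : {mpoly K[n]}).@[x 0].
  elim: k => [|k IH] kd; first by rewrite ffactn0 mul1r.
  have := foldr_dirderiv_homog (nseq k x) (SymPow_homog phi).
  rewrite size_nseq => /(euler x) /= ->.
  by rewrite IH 1?ltnW // ffactnSr mulnC natrM mulrA.
have := ev d (leqnn d); rewrite ffactnn /polar.
set p := foldr _ _ _ => ep.
have : p \is 0.-homog.
  by have := foldr_dirderiv_homog (nseq d x) (SymPow_homog phi);
    rewrite size_nseq subnn.
move=> hp; have pc : p = (p@_0)%:MP.
  apply/mpolyP=> m; rewrite mcoeffC; case: eqVneq => [->|m0];
    first by rewrite mulr1.
  by rewrite mulr0 (dhomog_nemf_coeff hp) // mdeg_eq0.
move: ep; rewrite {1}pc mevalC => ->.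
by rewrite mulrA mulVf ?mul1r // pnatr_eq0 -lt0n fact_gt0.
Qed.

Lemma flatteningE (d s : nat) (phi : SymPow K n d) (p : SymPow K n s)
    (xs ys : seq 'rV[K]_n) :
  (p : {mpoly K[n]}) = \prod_(x <- xs) linform x ->
  polar (flattening phi s p) ys = polar phi (xs ++ ys).
Proof.
move=> ep; rewrite /flattening lfunE /=.
rewrite (@polar_perm _ _ _ _ (xs ++ ys) (ys ++ xs));
  last by rewrite perm_catC.
rewrite /polar foldr_cat linearZ /= /form_poly /= -/(form_poly p).
rewrite ep contract_prod.
have Z c (q : {mpoly K[n]}) :
    foldr dirderiv (c *: q) ys = c *: foldr dirderiv q ys.
  by elim: ys => //= y ys ->; rewrite linearZ.
rewrite Z mcoeffZ mulrA; congr (_ * _).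
by rewrite mulrA mulVf ?mul1r // pnatr_eq0 -lt0n fact_gt0.
Qed.

End CharacteristicZero.

Section Projective.
Context {K : fieldType} {n : nat}.

(* P(K^n), as the set of lines of K^n. *)
Definition projspace : Type := {L : {vspace 'rV[K]_n} | \dim L == 1%N}.

Definition hcoord (P : projspace) (x : 'rV[K]_n) : Prop :=
  x != 0 /\ sval P = <[x]>%VS.

(* Used for homogeneous p only, where it does not depend on the choice of the
   homogeneous coordinates x of P. *)
Definition vanishes_at (p : {mpoly K[n]}) (P : projspace) : Prop :=
  forall x, hcoord P x -> p.@[x 0] = 0.

Definition Zeros (d : nat) (phi : SymPow K n d) : set projspace :=
  [set P | vanishes_at phi P].

Definition Sigma (s d : nat) (phi : SymPow K n d) : set projspace :=
  [set P | Zeros phi P /\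
    forall m : 'X_{1..n}, (mdeg m <= s)%N -> vanishes_at phi^`M[m] P].

Definition zariski_closed (Z : set projspace) : Prop :=
  exists S : set {mpoly K[n]},
    (forall p, S p -> p \is homog mdeg) /\
    Z = [set P | forall p, S p -> vanishes_at p P].

Lemma Sigma_closed (s d : nat) (phi : SymPow K n d) :
  zariski_closed (Sigma s phi).
Proof.
exists [set p : {mpoly K[n]} | p = phi \/
  exists2 m, (mdeg m <= s)%N & p = phi^`M[m]]; split.
  move=> p [->|[m _ ->]]; apply/homogP; first by exists d; exact: SymPow_homog.
  exists (d - mdeg m)%N; rewrite -contractX.
  by apply: contract_homog (SymPow_homog phi); rewrite dhomogX.
apply/seteqP; split=> P /=.
  by move=> [z h] p [->|[m ms ->]] //; exact: h.
by move=> h; split=> [|m ms]; apply: h; [left|right; exists m].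
Qed.

Definition irreducible_closed (Z : set projspace) : Prop :=
  [/\ zariski_closed Z, Z !=set0 &
    forall A B, zariski_closed A -> zariski_closed B ->
      Z `<=` A `|` B -> Z `<=` A \/ Z `<=` B].

Definition chain_of_length (X : set projspace) (k : nat) : Prop :=
  exists Z : nat -> set projspace,
    (forall i, (i <= k)%N -> irreducible_closed (Z i) /\ Z i `<=` X) /\
    (forall i, (i < k)%N -> Z i `<` Z i.+1).

End Projective.
Arguments projspace : clear implicits.

Section Invariants.
Context {R : realType} {n : nat}.
Local Open Scope ereal_scope.

(* Krull dimension in the Zariski topology.  The irreducible closed subsets of
   a closed X are those of the ambient space that are contained in X. *)
Definition proj_dim (X : set (projspace R[i] n)) : \bar R :=
  if `[< X = set0 >] then (- 1)%:E
  else ereal_sup [set k%:R%:E | k in chain_of_length X].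

Definition waring_rank (d : nat) (phi : SymPow R[i] n d) : \bar R :=
  ereal_inf [set r%:R%:E | r in waring_decomposable phi].

End Invariants.

(* Main.v *)
Require Import Defs.
From mathcomp Require Import all_boot all_order all_algebra complex mpoly.
From mathcomp Require Import boolp classical_sets reals constructive_ereal ereal.
From mathcomp Require Import zify ring lra.

(* Let phi = l_1^d + ... + l_r^d.  The flattening of phi sends p to a multiple of
   the sum of the p(l_j) l_j^(d-s), so its rank rho is at most that of the
   vectors (p(l_j))_j in C^r, p of degree s.  At a point x of Sigma_s(phi) all
   derivatives p(d/dX) phi vanish, i.e. (<l_j, x>^(d-s))_j is orthogonal to these
   vectors; as the orthogonal space has dimension at most r - rho, some r - rho
   of the coordinates determine its elements.  Since the l_j span C^n, the
   corresponding linear forms <l_j, .> have no common zero on Sigma_s(phi), so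
   dim Sigma_s(phi) < r - rho.

   For this last step let Z_0 < ... < Z_k be irreducible closed sets on which m
   linear forms y_j have no common zero.  Forms f_i vanishing on Z_(i-1) but not
   on Z_i give t^(k+1) monomials (exponents below t) of degree O(t) that are
   independent modulo the ideal of Z_k, while by the Nullstellensatz the
   polynomials of degree O(t) modulo that ideal are spanned by O(t^m) products of
   a monomial in the y_j with a monomial of bounded degree; so k + 1 <= m. *)

Import Order.TTheory GRing.Theory Num.Theory.

Local Open Scope classical_set_scope.

Section Lemmas.

Set Implicit Arguments.
Unset Strict Implicit.
Unset Printing Implicit Defensive.

Local Open Scope ring_scope.

(** * Uncountability of the complex numbers *)

(* The form in which the uncountability of C enters the Nullstellensatz below. *)
Definition large_fibres (T : choiceType) := forall g : T -> nat,
  exists N, forall k, exists s : seq T,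
    [/\ uniq s, size s = k & forall x, x \in s -> g x = N].

(** A list of distinct elements satisfying [P] that cannot be prolonged contains all of them. *)
Lemma exhausting_seq (T : choiceType) (P : T -> Prop) k :
  ~ (exists s : seq T, [/\ uniq s, size s = k & forall x, x \in s -> P x]) ->
  exists F : seq T, forall x, P x -> x \in F.
Proof.
elim: k => [|k IH] ns; first by case: ns; exists [::].
have [[s [us ss Ps]]|/IH //] := pselect (exists s : seq T,
  [/\ uniq s, size s = k & forall x, x \in s -> P x]).
exists s => x Px; apply/negPn/negP => xs; case: ns; exists (x :: s).
split; [by rewrite /= xs | by rewrite /= ss|].
by move=> y; rewrite inE => /orP[/eqP-> //|/Ps].
Qed.

Lemma subinterval_avoiding (R : realType) (F : seq R) (a b : R) : a < b ->
  exists c : R * R, [/\ a <= c.1, c.2 <= b, c.1 < c.2 &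
    forall x, x \in F -> ~ (c.1 <= x <= c.2)].
Proof.
move=> ab; elim: F => [|y F [[c e] /= [ac eb ce H]]]; first by exists (a, b).
have [yc|cy] := ltP y ((c + e) / 2).
  exists ((c + e) / 2, e) => /=; split=> //; [lra|lra|] => x.
  rewrite inE => /orP[/eqP->|/H h] /andP[h1 h2]; first lra.
  by apply: h; apply/andP; split=> //; lra.
(* Here [y] may equal the midpoint, so the right end is taken strictly to its left, at one third of
   the interval. *)
exists (c, (2 * c + e) / 3) => /=; split=> //; [lra|lra|] => x.
rewrite inE => /orP[/eqP->|/H h] /andP[h1 h2]; first lra.
by apply: h; apply/andP; split=> //; lra.
Qed.

(* If all fibres were finite, nested intervals could avoid the n-th fibre at the
   n-th step. *)
Lemma large_fibres_real (R : realType) : large_fibres R.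
Proof.
move=> g; apply: contrapT => H.
have finF N : exists F : seq R, forall x, g x = N -> x \in F.
  have /existsNP[k Hk] : ~ forall k, exists s : seq R,
      [/\ uniq s, size s = k & forall x, x \in s -> g x = N].
    by move=> h; apply: H; exists N.
  exact: exhausting_seq Hk.
have [F hF] := choice finF.
have step (Nc : nat * (R * R)) : exists c : R * R, Nc.2.1 < Nc.2.2 ->
    [/\ Nc.2.1 <= c.1, c.2 <= Nc.2.2, c.1 < c.2 &
    forall x, x \in F Nc.1 -> ~ (c.1 <= x <= c.2)].
  have [/(subinterval_avoiding (F Nc.1))[c hc]|h] := ltP Nc.2.1 Nc.2.2.
    by exists c.
    by exists (0, 0).
have [G hG] := choice step.
pose I := fix I n := if n is n'.+1 then G (n', I n') else (0, 1).
have Ilt n : (I n).1 < (I n).2.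
  by elim: n => [|n IH] /=; [exact: ltr01|case: (hG (n, I n) IH)].
have Iin n k : (I n).1 <= (I (k + n)%N).1 /\ (I (k + n)%N).2 <= (I n).2.
  elim: k => [|k [h1 h2]]; first by rewrite add0n.
  rewrite addSn /=; have [/= h3 h4 _ _] := hG ((k + n)%N, I (k + n)%N) (Ilt _).
  by split; [apply: le_trans h1 h3 | apply: le_trans h4 h2].
have Ile n k : (I n).1 <= (I k).2.
  have [h1 _] := Iin n k; have [_ h2] := Iin k n.
  by rewrite (le_trans h1) // (le_trans _ h2) // addnC ltW.
pose A := [set (I n).1 | n in [set: nat]].
have ubA k : ubound A (I k).2 by move=> _ [n _ <-].
have hs : has_sup A by split; [exists (I 0).1; exists 0%N | exists (I 0).2].
pose x := sup A.
(* The point [x] lies in every interval, in particular in the one of index [(g x).+1], which avoids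
   the fibre of [g] that contains [x]. *)
have [_ _ _ /(_ x)] := hG (g x, I (g x)) (Ilt _); apply; first exact: hF.
apply/andP; split; last by have := ge_sup hs.1 (ubA (g x).+1).
have := ub_le_sup hs.2; apply; exists (g x).+1 => //.
Qed.

Lemma large_fibres_inj (T U : choiceType) (f : T -> U) :
  injective f -> large_fibres T -> large_fibres U.
Proof.
move=> fI hT g; have [N hN] := hT (g \o f); exists N => k.
have [s [us ss hs]] := hN k; exists (map f s).
rewrite size_map map_inj_uniq //; split=> // _ /mapP[x xs ->]; exact: hs.
Qed.

Lemma large_fibres_complex (R : realType) : large_fibres R[i].
Proof.
apply: (@large_fibres_inj R _ (fun x => Complex x 0)); last first.
  exact: large_fibres_real.
by move=> x y [].
Qed.

Lemma homogeneous_system_solution (K : fieldType) (I J : finType)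
    (A : I -> J -> K) : (#|J| < #|I|)%N ->
  exists c : I -> K, (exists i, c i != 0) /\
    forall j, \sum_i c i * A i j = 0.
Proof.
move=> JI.
pose M := \matrix_(i < #|I|, j < #|J|) A (enum_val i) (enum_val j).
have : kermx M != 0.
  rewrite -mxrank_eq0 mxrank_ker subn_eq0 -ltnNge.
  exact: leq_ltn_trans (rank_leq_col M) JI.
case/rowV0Pn=> v /sub_kermxP vM v0.
exists (fun i => v 0 (enum_rank i)); split.
  have /rV0Pn[i vi] := v0; exists (enum_val i); by rewrite enum_valK.
move=> j; have /matrixP/(_ 0 (enum_rank j)) := vM; rewrite !mxE => e.
rewrite -[RHS]e.
rewrite [RHS](reindex (@enum_rank I)) /=; last first.
  by exists enum_val => i _; rewrite ?enum_valK ?enum_rankK.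
by apply: eq_bigr => i _; rewrite mxE !enum_rankK.
Qed.

(** * Ideals and the Nullstellensatz *)

Section Ideals.
Context {K : fieldType} {n : nat}.
Implicit Types (J : set {mpoly K[n]}) (p q : {mpoly K[n]}).

Definition ideal_set J := [/\ J 0, forall p q, J p -> J q -> J (p + q) &
  forall p q, J q -> J (p * q)].

Lemma ideal_sum J (I : Type) (r : seq I) (P : pred I) F :
  ideal_set J -> (forall i, P i -> J (F i)) -> J (\sum_(i <- r | P i) F i).
Proof. by move=> [J0 JD _] h; elim/big_ind: _. Qed.

Lemma ideal_opp J p : ideal_set J -> J p -> J (- p).
Proof. by move=> [_ _ JM] /(JM (- 1)); rewrite mulN1r. Qed.

Lemma ideal_scale J c p : ideal_set J -> J p -> J (c *: p).
Proof. by move=> [_ _ JM] /(JM c%:MP); rewrite mul_mpolyC. Qed.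

End Ideals.

Section Nullstellensatz.
Variables (K : closedFieldType) (n : nat).
Hypothesis K_large : large_fibres K.
Implicit Types (J M : set {mpoly K[n]}) (f g p : {mpoly K[n]}).

(** The case [N = 0] makes [M] proper. Ideals maximal with this property correspond to the maximal
    ideals of the localization at [f]. *)
Definition avoids_powers f M := ideal_set M /\ forall N, ~ M (f ^+ N).

Definition adjoin M g : set {mpoly K[n]} :=
  [set p | exists q a, M q /\ p = q + a * g].

Lemma adjoin_ideal M g : ideal_set M -> ideal_set (adjoin M g).
Proof.
move=> [M0 MD MM]; split=> [|_ _ [q [a [Mq ->]]] [q' [a' [Mq' ->]]]|].
- by exists 0, 0; rewrite mul0r addr0.
- by exists (q + q'), (a + a'); rewrite mulrDl addrACA; split=> //; apply: MD.
- move=> p _ [q [a [Mq ->]]]; exists (p * q), (p * a).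
  by rewrite mulrDr mulrA; split=> //; apply: MM.
Qed.

Lemma maximal_avoiding J f : avoids_powers f J ->
  exists M, [/\ J `<=` M, avoids_powers f M &
    forall g, ~ M g -> exists N, adjoin M g (f ^+ N)].
Proof.
move=> hJ.
pose P (X : set {mpoly K[n]}) := X = set0 \/ (J `<=` X /\ avoids_powers f X).
have [|M [PM Mmax]] := @Zorn_bigcup _ P.
  move=> F FP Ftot.
  have [[X FX X0]|h] := pselect (exists2 X, F X & X !=set0); last first.
    left; rewrite -subset0 => x [X FX Xx]; case: h; by exists X; last exists x.
  have PX Y y : F Y -> Y y -> J `<=` Y /\ avoids_powers f Y.
    by move=> FY Yy; have [Y0|] := FP _ FY; [rewrite Y0 in Yy|].
  have [x Xx] := X0; have [JX [idX _]] := PX _ _ FX Xx.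
  right; split; first by move=> p Jp; exists X => //; apply: JX.
  split; last first.
    by move=> N [Y FY YN]; have [_ [_ /(_ N)]] := PX _ _ FY YN.
  split; first by exists X => //; case: idX.
    move=> p q [Y FY Yp] [Y' FY' Yq].
    have [YY'|YY'] := Ftot _ _ FY FY'.
      exists Y' => //; have [_ [[_ h _] _]] := PX _ _ FY' Yq.
      by apply: h => //; apply: YY'.
    exists Y => //; have [_ [[_ h _] _]] := PX _ _ FY Yp.
    by apply: h => //; apply: YY'.
  move=> p q [Y FY Yq]; exists Y => //.
  by have [_ [[_ _ h] _]] := PX _ _ FY Yq; apply: h.
have J0 : J 0 by case: hJ => -[].
have {PM} [M0|[JM aM]] := PM.
  case: (Mmax J); last by right; split.
  by rewrite M0; split=> // /(_ 0 J0).
exists M; split=> // g Mg; apply: contrapT => h.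
case: (Mmax (adjoin M g)).
  split; last first.
    move=> /(_ g) h1; apply: Mg; apply: h1; exists 0, 1.
    by rewrite mul1r add0r; split=> //; case: aM => -[].
  by move=> p Mp; exists p, 0; rewrite mul0r addr0.
right; split.
  by move=> p /JM Mp; exists p, 0; rewrite mul0r addr0.
split; first by apply: adjoin_ideal; case: aM.
by move=> N hN; apply: h; exists N.
Qed.

Section Maximal.
Variables (f : {mpoly K[n]}) (M : set {mpoly K[n]}).
Hypotheses (Mf : avoids_powers f M)
  (Mmax : forall g, ~ M g -> exists N, adjoin M g (f ^+ N)).

Let idM : ideal_set M. Proof. by case: Mf. Qed.

(** Were neither factor in [M], powers of [f] would lie in M + (g) and in M + (h), and their product
    in M + (gh), which is [M]. *)
Lemma maximal_prime g h : M (g * h) -> M g \/ M h.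
Proof.
move=> Mgh; apply: contrapT => /not_orP[/Mmax[N [q [a [Mq eN]]]]].
move=> /Mmax[N' [q' [a' [Mq' eN']]]].
have [[_ MD MM] /(_ (N + N')%N)] := Mf; apply.
rewrite exprD eN eN' mulrDl; apply: (MD); first by rewrite mulrC; apply: (MM).
rewrite mulrDr; apply: (MD); first exact: MM.
by rewrite mulrACA; apply: MM.
Qed.

Lemma maximal_unit c : c != 0 -> ~ M c%:MP.
Proof.
move=> c0 Mc; case: Mf => _ /(_ 0%N); apply; rewrite expr0.
by rewrite -(mpolyC1 n K) -(mulVf c0) mpolyCM; case: idM => _ _; apply.
Qed.

Lemma maximal_prod (I : Type) (r : seq I) (F : I -> {mpoly K[n]}) :
  M (\prod_(i <- r) F i) -> exists i, M (F i).
Proof.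
elim: r => [|i r IH].
  by rewrite big_nil -mpolyC1 => /maximal_unit; rewrite oner_neq0 => /(_ isT).
by rewrite big_cons => /maximal_prime[Mi|/IH //]; exists i.
Qed.

(* Amitsur's argument: otherwise f^N = u_a (X_j - a) mod M for every a, and too
   many of the u_a lie in a space of finite dimension. *)
Lemma maximal_point (j : 'I_n) : exists a : K, M ('X_j - a%:MP).
Proof.
apply: contrapT => /forallNP H.
have /choice[w hw] (a : K) : exists w : nat * {mpoly K[n]},
    M (f ^+ w.1 - w.2 * ('X_j - a%:MP)).
  have [N [q [u [Mq e]]]] := Mmax (H a); exists (N, u).
  by rewrite /= e addrK.
(* [pickle] codes the exponent and the size of the multiplier as one number, so arbitrarily many
   scalars share both. *)
have [D hD] := K_large (fun a => pickle ((w a).1, msize (w a).2)).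
have [s0 [_ ss0 /(_ (head 0 s0))]] := hD 1%N.
have -> : head 0 s0 \in s0 by case: s0 ss0 => //= x s _; rewrite mem_head.
set N := (w (head 0 s0)).1; set B := msize (w (head 0 s0)).2 => /(_ isT) eD.
(* One more than the number of monomials of degree below [B]: any [k] multipliers of size [B] are
   linearly dependent. *)
pose k := #|{: 'X_{1..n < B}}|.+1.
have [s [us ss hs]] := hD k.
pose t (i : 'I_k) := nth 0 s i.
have ht i : w (t i) = (N, (w (t i)).2) /\ msize (w (t i)).2 = B.
  have : t i \in s by rewrite mem_nth // ss.
  move=> /hs; rewrite -eD => /(pcan_inj pickleK)[<- ->]; split=> //.
  by case: (w _).
have tI : injective t.
  move=> i i' /eqP; rewrite nth_uniq ?ss // => /eqP; exact: val_inj.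
have [c [[i0 ci0] hc]] := @homogeneous_system_solution K 'I_k 'X_{1..n < B}
  (fun i m => (w (t i)).2@_m) ltac:(by rewrite card_ord).
(* With sum c_i u_i = 0, the element f^N L(X_j) equals the sum of the c_i (f^N - u_i (X_j - t_i))
   prod_(i' != i) (X_j - t_i'), since the subtracted terms add up to (sum c_i u_i) prod (X_j - t_i).
   So it lies in [M], while L is nonzero at t_(i0). *)
pose L : {poly K} := \sum_i c i *: \prod_(i' | i' != i) ('X - (t i')%:P).
have L0 : L != 0.
  apply/eqP => /(congr1 (fun q : {poly K} => q.[t i0])) /eqP; apply/negP.
  rewrite horner0 /L horner_sum (bigD1 i0) //=.
  rewrite [X in _ + X]big1 ?addr0; last first.
    move=> i ne; rewrite hornerZ horner_prod (bigD1 i0) //=; last first.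
      by rewrite eq_sym.
    by rewrite hornerXsubC subrr mul0r mulr0.
  rewrite hornerZ mulf_neq0 // horner_prod; apply/prodf_neq0 => i ne.
  by rewrite hornerXsubC subr_eq0; apply: contraNneq ne => /tI ->.
have ML : M (horner_alg ('X_j : {mpoly K[n]}) L).
  suff : M (f ^+ N * horner_alg 'X_j L).
    by move/maximal_prime => -[] //; case: Mf => _ /(_ N).
  rewrite /L linear_sum mulr_sumr.
  have -> : \sum_i f ^+ N * horner_alg ('X_j : {mpoly K[n]})
      (c i *: \prod_(i' | i' != i) ('X - (t i')%:P)) =
    \sum_i (c i *: \prod_(i' | i' != i) ('X_j - (t i')%:MP)) *
       (f ^+ N - (w (t i)).2 * ('X_j - (t i)%:MP)).
    apply/eqP; rewrite -subr_eq0 -sumrB.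
    rewrite [X in X == _](_ : _ = (\sum_i c i *: (w (t i)).2) *
      \prod_i ('X_j - (t i)%:MP)).
      rewrite (_ : \sum_i _ = 0) ?mul0r //; apply/mpolyP => m.
      rewrite mcoeff0 linear_sum /=.
      have [mB|mB] := ltnP (mdeg m) B.
        rewrite -[RHS](hc (BMultinom mB)) /=; apply: eq_bigr => i _.
        by rewrite mcoeffZ.
      rewrite big1 // => i _; rewrite mcoeffZ memN_msupp_eq0 ?mulr0 //.
      by apply: msize_mdeg_ge; rewrite (ht i).2.
    rewrite mulr_suml; apply: eq_bigr => i _.
    rewrite linearZ /= rmorph_prod /= mulr_algl.
    under eq_bigr do rewrite rmorphB /= horner_algX horner_algC alg_mpolyC.
    rewrite [in RHS](bigD1 i) //= -!scalerAl -scalerAr -scalerBr.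
    congr (_ *: _); ring.
  apply: ideal_sum => // i _; have [_ _] := idM; apply.
  by have := hw (t i); rewrite (ht i).1.
(* [L] splits into linear factors, and the prime ideal [M] contains one of them evaluated at X_j. *)
have [r er] := closed_field_poly_normal L.
move: ML; rewrite er linearZ /= mulr_algl -mul_mpolyC => /maximal_prime[].
  by apply: maximal_unit; rewrite lead_coef_eq0.
rewrite rmorph_prod /= => /maximal_prod[z].
by rewrite rmorphB /= horner_algX horner_algC alg_mpolyC; apply: H.
Qed.

(** Modulo [M] each variable is a constant by [maximal_point], and congruence to the value at [a] is
    stable under sums and products. *)
Lemma maximal_zero : exists a : 'I_n -> K, forall p, M (p - (p.@[a])%:MP).
Proof.
have /choice[a ha] := maximal_point; exists a.
have [M0 MD MM] := idM.
have QC c : M (c%:MP - (c%:MP.@[a])%:MP) by rewrite mevalC subrr.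
have QM p q : M (p - (p.@[a])%:MP) -> M (q - (q.@[a])%:MP) ->
    M (p * q - ((p * q).@[a])%:MP).
  move=> Mp Mq; rewrite mevalM mpolyCM.
  rewrite (_ : _ - _ = p * (q - q.@[a]%:MP) + q.@[a]%:MP * (p - p.@[a]%:MP)).
    by apply: MD; apply: MM.
  ring.
move=> p; rewrite [p]mpolyE; elim/big_ind: _ => [|x y|m _].
- by rewrite -mpolyC0.
- by move=> Mx My; rewrite mevalD mpolyCD opprD addrACA; apply: MD.
- rewrite -mul_mpolyC; apply: (QM) => //; rewrite mpolyXE_id.
  elim/big_ind: _ => [||i _]; first by rewrite -mpolyC1.
    exact: (QM).
  elim: (m i) => [|k IH]; first by rewrite expr0 -mpolyC1.
  by rewrite exprS; apply: (QM) => //; rewrite mevalXU.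
Qed.

End Maximal.

(** Otherwise some ideal above [J], maximal among those avoiding the powers of [f], has a zero [a].
    There [J] vanishes, hence so does [f], which puts [f] into that ideal. *)
Lemma nullstellensatz J f : ideal_set J ->
  (forall a : 'I_n -> K, (forall p, J p -> p.@[a] = 0) -> f.@[a] = 0) ->
  exists N, J (f ^+ N).
Proof.
move=> idJ H; apply: contrapT => /forallNP h.
have [M [JM Mf Mmax]] := @maximal_avoiding J f (conj idJ h).
have [a ha] := maximal_zero Mf Mmax.
have [[_ MD _] Mn] := Mf.
have fa : f.@[a] = 0.
  apply: H => p /JM Mp; apply/eqP/negPn/negP => /(maximal_unit Mf); apply.
  have := ha p; move/(ideal_opp (proj1 Mf)); rewrite opprB => /(MD _ _ Mp).
  by rewrite addrC subrK.
apply: (Mn 1%N); have := ha f; by rewrite fa mpolyC0 subr0 expr1.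
Qed.

End Nullstellensatz.

(** * Degrees and homogeneous components *)

Section Degree.
Context {K : fieldType} {n : nat}.
Implicit Types (p q h : {mpoly K[n]}).

Lemma msize_mul_le p q a b : (msize p <= a.+1)%N -> (msize q <= b.+1)%N ->
  (msize (p * q) <= (a + b).+1)%N.
Proof.
have [->|p0] := eqVneq p 0; first by rewrite mul0r msize0.
have [->|q0] := eqVneq q 0; first by rewrite mulr0 msize0.
rewrite msizeM // => ha hb.
by rewrite -subn1 leq_subLR add1n -addnS -addSn leq_add.
Qed.

Lemma msize_exp_le p a k : (msize p <= a.+1)%N ->
  (msize (p ^+ k) <= (k * a).+1)%N.
Proof.
move=> hp; elim: k => [|k IH]; first by rewrite expr0 msize1.
by rewrite exprS mulSn; apply: msize_mul_le.
Qed.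

Lemma dhomog_msize_le p d : p \is d.-homog -> (msize p <= d.+1)%N.
Proof.
move=> hp; rewrite msizeE; apply/bigmax_leqP_seq => m mp _.
by rewrite (dhomog_mf hp mp).
Qed.

Lemma pihomog_geq_msize p d : (msize p <= d)%N -> pihomog mdeg d p = 0.
Proof.
move=> hp; rewrite pihomogE big_seq_cond big1 // => m /andP[mp /eqP dm].
by have := msize_mdeg_lt mp; rewrite dm ltnNge hp.
Qed.

Lemma pihomog_mulr h q e d : h \is e.-homog ->
  pihomog mdeg (d + e)%N (q * h) = pihomog mdeg d q * h.
Proof.
move=> hh; pose k := maxn (msize q) d.+1.
have hq : (msize q <= k)%N by rewrite leq_maxl.
have hd : (d < k)%N by rewrite leq_maxr.
rewrite {1}(pihomog_partitionE hq) mulr_suml linear_sum /=.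
rewrite (bigD1 (Ordinal hd)) //= big1 ?addr0 => [|i ne].
  by rewrite pihomog_dE // dhomogM // pihomogP.
apply: (@pihomog_ne0 _ _ _ (i + e)%N); last by rewrite dhomogM // pihomogP.
by rewrite eqn_add2r.
Qed.

Lemma meval_dhomog_scale p d c (x : 'rV[K]_n) : p \is d.-homog ->
  p.@[(c *: x) 0] = c ^+ d * p.@[x 0].
Proof.
move=> hp; rewrite !mevalE mulr_sumr big_seq [RHS]big_seq.
apply: eq_bigr => m mp; rewrite mulrCA; congr (_ * _).
have <- := dhomog_mf hp mp; rewrite /= mdegE -prodrXr -big_split /=.
by apply: eq_bigr => i _; rewrite mxE exprMn.
Qed.

Lemma meval_scale p c (x : 'rV[K]_n) :
  p.@[(c *: x) 0] = \sum_(d < msize p) c ^+ d * (pihomog mdeg d p).@[x 0].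
Proof.
rewrite {1}(pihomog_partitionE (leqnn (msize p))) raddf_sum /=.
by apply: eq_bigr => d _; rewrite (meval_dhomog_scale _ _ (pihomogP _ _ _)).
Qed.

Lemma card_bmultinom_le D : (#|{: 'X_{1..n < D.+1}}| <= D.+1 ^ n)%N.
Proof.
rewrite -[X in (_ <= X ^ _)%N](card_ord D.+1) -[n in (_ <= _ ^ n)%N]card_ord.
rewrite -card_ffun.
pose f (a : 'X_{1..n < D.+1}) := [ffun i : 'I_n => inord (a i) : 'I_D.+1].
apply: (leq_card f) => a b /ffunP e; apply/val_inj/mnmP => i.
have lt (c : 'X_{1..n < D.+1}) : (c i < D.+1)%N.
  by rewrite (leq_ltn_trans _ (bmdeg c)) // mdegE (bigD1 i) //= leq_addr.
by have := e i; rewrite !ffunE => /(congr1 val); rewrite /= !inordK.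
Qed.

End Degree.

(** On the multiples of [x], the values of [p] form a polynomial in the scalar whose coefficients
    are the values of the components. The scalars 1, 2, ... are distinct and nonzero in
    characteristic 0 and give it too many roots. *)
Lemma meval_cone_pihomog (K : numFieldType) n (p : {mpoly K[n]})
    (x : 'rV[K]_n) :
  (forall c, c != 0 -> p.@[(c *: x) 0] = 0) ->
  forall d, (pihomog mdeg d p).@[x 0] = 0.
Proof.
move=> h d; pose q := \poly_(d < msize p) (pihomog mdeg d p).@[x 0].
have q0 : q = 0.
  apply: (@roots_geq_poly_eq0 _ _ [seq i.+1%:R | i <- iota 0 (msize p)]).
  - apply/allP => _ /mapP[i _ ->].
    have := h i.+1%:R; rewrite pnatr_eq0 meval_scale /root horner_poly.
    by move/(_ isT) => e; apply/eqP; rewrite -[RHS]e; apply: eq_bigr => j _;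
      rewrite mulrC.
  - rewrite map_inj_uniq ?iota_uniq // => i j /eqP.
    by rewrite eqr_nat eqSS => /eqP.
  - by rewrite size_map size_iota size_poly.
have [dp|dp] := ltnP d (msize p); last first.
  by rewrite pihomog_geq_msize // meval0.
by have := congr1 (fun q : {poly K} => q`_d) q0; rewrite coef_poly dp coef0.
Qed.

(** * Polynomials of bounded degree modulo an ideal *)

Section Spanning.
Context {K : fieldType} {n m : nat}.
Variables (I : set {mpoly K[n]}) (y : m.-tuple {mpoly K[n]}).
Hypothesis idI : ideal_set I.

Definition ideal_add : set {mpoly K[n]} :=
  [set p | exists q (r : 'I_m -> {mpoly K[n]}),
     I q /\ p = q + \sum_j r j * tnth y j].

Lemma ideal_add_ideal : ideal_set ideal_add.
Proof.
have [I0 ID IM] := idI; split.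
- by exists 0, (fun=> 0); rewrite big1 ?addr0 // => j _; rewrite mul0r.
- move=> _ _ [q [r [Iq ->]]] [q' [r' [Iq' ->]]].
  exists (q + q'), (fun j => r j + r' j); split; first exact: ID.
  rewrite addrACA -big_split /=; congr (_ + _).
  by apply: eq_bigr => j _; rewrite mulrDl.
- move=> p _ [q [r [Iq ->]]]; exists (p * q), (fun j => p * r j).
  split; first exact: IM.
  rewrite mulrDr mulr_sumr; congr (_ + _).
  by apply: eq_bigr => j _; rewrite mulrA.
Qed.

Variable B : nat.

(** As [msize] is the degree plus one, the coefficients are polynomials of degree at most [D] in the
    y_j. For fixed [B] they form a space of dimension O(D^m). *)
Definition spanned D p := exists g : 'X_{1..n < B} -> {mpoly K[m]},
  (forall u, (msize (g u) <= D.+1)%N) /\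
  I (p - \sum_u (g u \mPo y) * 'X_[u]).

Lemma spanned_ideal D p : I p -> spanned D p.
Proof.
move=> Ip; exists (fun=> 0); split=> [u|]; first by rewrite msize0.
by rewrite big1 ?subr0 // => u _; rewrite comp_mpoly0 mul0r.
Qed.

Lemma spannedD D p q : spanned D p -> spanned D q -> spanned D (p + q).
Proof.
move=> [g [hg Ip]] [g' [hg' Iq]]; exists (fun u => g u + g' u); split=> [u|].
  by rewrite (leq_trans (mmeasureD_le _ _ _)) // geq_max hg hg'.
under eq_bigr do rewrite comp_mpolyD mulrDl.
by rewrite big_split /= opprD addrACA; case: idI => _ + _; apply.
Qed.

Lemma spanned_sum D (T : Type) (r : seq T) (P : pred T) F :
  (forall i, P i -> spanned D (F i)) -> spanned D (\sum_(i <- r | P i) F i).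
Proof.
move=> h; elim/big_ind: _ => //; last exact: spannedD.
by apply: spanned_ideal; case: idI.
Qed.

Lemma spannedZ D c p : spanned D p -> spanned D (c *: p).
Proof.
move=> [g [hg Ip]]; exists (fun u => c *: g u); split=> [u|].
  exact: leq_trans (msizeZ_le _ _) (hg u).
under eq_bigr do rewrite comp_mpolyZ -scalerAl.
by rewrite -scaler_sumr -scalerBr; apply: ideal_scale.
Qed.

Lemma spanned_mul_gen D p j : spanned D p -> spanned D.+1 (p * tnth y j).
Proof.
move=> [g [hg Ip]]; exists (fun u => g u * 'X_j); split=> [u|].
  by rewrite -addn1; apply: msize_mul_le => //; rewrite msizeX mdeg1.
rewrite (_ : _ - _ = tnth y j * (p - \sum_u (g u \mPo y) * 'X_[u])).
  by case: idI => _ _; apply.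
rewrite mulrBr mulrC; congr (_ - _); rewrite mulr_sumr; apply: eq_bigr => u _.
by rewrite rmorphM /= comp_mpolyXU -tnth_nth mulrAC mulrC.
Qed.

Lemma spanned_small D (a : 'X_{1..n}) : (mdeg a < B)%N -> spanned D 'X_[a].
Proof.
move=> aB; pose u0 := BMultinom aB.
exists (fun u => (u == u0)%:R); split=> [u|].
  by case: (u == u0); rewrite ?msize1 ?msize0.
rewrite (bigD1 u0) //= eqxx comp_mpoly1 mul1r big1 ?addr0 ?subrr.
  by case: idI.
by move=> u /negbTE->; rewrite comp_mpoly0 mul0r.
Qed.

End Spanning.

Section Finiteness.
Context {K : fieldType} {n m : nat}.
Variables (I : set {mpoly K[n]}) (y : m.-tuple {mpoly K[n]}).
Hypotheses (idI : ideal_set I)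
  (I_homog : forall d p, I p -> I (pihomog mdeg d p))
  (y_lin : forall j, tnth y j \is 1.-homog)
  (y_pow : forall i : 'I_n, exists N, ideal_add I y ('X_i ^+ N)).

(** A monomial of large degree contains a high power of some variable, which modulo [I] is a
    combination of the y_j. Splitting off a factor y_j lowers the degree by one, and induction on
    [D] applies. *)
Lemma finite_spanning : exists B, forall D p, (msize p <= D.+1)%N ->
  spanned I y B D p.
Proof.
have /choice[N hN] := y_pow.
pose M := (\max_i N i)%N.
have hM i : ideal_add I y ('X_i ^+ M.+1).
  have [k ->] : exists k, M.+1 = (k + N i)%N.
    by exists (M.+1 - N i)%N; rewrite subnK // ltnW // ltnS /M leq_bigmax.
  by rewrite exprD; have [_ _] := ideal_add_ideal y idI; apply.
(* A monomial of degree above n M has an exponent above [M]. *)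
exists (n * M).+1; set B := (n * M).+1; elim=> [|D IH] p hp.
  rewrite [p]mpolyE big_seq; apply: spanned_sum => // a ap.
  apply: spannedZ => //; apply: spanned_small => //.
  by have := leq_trans (msize_mdeg_lt ap) hp; rewrite ltnS leqn0 => /eqP->.
rewrite [p]mpolyE big_seq; apply: spanned_sum => // a ap.
apply: spannedZ => //.
have [aB|Ba] := ltnP (mdeg a) B; first exact: spanned_small.
have aD : (mdeg a <= D.+1)%N.
  by rewrite -ltnS; apply: leq_trans (msize_mdeg_lt ap) hp.
have [i ai] : exists i, (M < a i)%N.
  apply: contrapT => /forallNP h.
  move: Ba; rewrite /B ltnNge mdegE; apply/negP/negPn.
  rewrite -[X in (_ <= X * _)%N]card_ord -sum_nat_const.
  by apply: leq_sum => i _; rewrite leqNgt; apply/negP/h.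
have [q [r [Iq e]]] := hM i.
(* Taking the component of degree M + 1 keeps the first term in [I] and makes the cofactors of the
   y_j homogeneous of degree [M], so that degrees stay under control. *)
have /(congr1 (pihomog mdeg (M + 1)%N)) := e.
rewrite pihomog_dE; last first.
  by rewrite mpolyXn dhomogX /= mdegMn mdeg1 mul1n addn1.
rewrite linearD linear_sum /=.
under eq_bigr do rewrite pihomog_mulr //.
move=> {}e.
have le : (U_(i) *+ M.+1 <= a)%MM.
  apply/mnm_lepP => k; rewrite mulmnE mnmE.
  by case: eqP => [<-|_]; rewrite ?mul1n ?mul0n.
rewrite -(submK le) mpolyXD -mpolyXn e mulrDr [X in _ + X]mulr_sumr.
apply: spannedD => //.
  by apply: spanned_ideal => //; case: idI => _ _; apply; apply: I_homog.
apply: spanned_sum => // j _; rewrite mulrA; apply: spanned_mul_gen => //.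
apply: IH.
have -> : D.+1 = ((D - M) + M).+1.
  rewrite subnK // -ltnS (leq_trans _ aD) // (leq_trans ai) //.
  by rewrite mdegE (bigD1 i) //= leq_addr.
apply: msize_mul_le; last exact/dhomog_msize_le/pihomogP.
rewrite msizeX ltnS.
have := congr1 mdeg (submK le); rewrite mdegD mdegMn mdeg1 mul1n.
by move: aD; clear; lia.
Qed.

End Finiteness.

(** * Counting independent polynomials *)

Section Counting.
Context {K : fieldType} {n : nat}.
Implicit Types (I J : set {mpoly K[n]}) (p q : {mpoly K[n]}).

Definition independent_mod I (T : finType) (b : T -> {mpoly K[n]}) :=
  forall c : T -> K, I (\sum_i c i *: b i) -> forall i, c i = 0.

(** Modulo [I] only the terms with exponent 0 of [p] survive in a relation, so their coefficients
    vanish. The rest is divisible by [p], which cancels modulo [J], and one repeats. *)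
Lemma independent_mod_powers I J p (T : finType) (b : T -> {mpoly K[n]}) k :
  ideal_set I -> J `<=` I -> I p -> (forall q, J (p * q) -> J q) -> J 0 ->
  independent_mod I b ->
  independent_mod J (fun u : 'I_k * T => p ^+ u.1 * b u.2).
Proof.
move=> [I0 ID IM] JI Ip pJ J0 indb c.
have -> : \sum_i c i *: (p ^+ i.1 * b i.2) =
    \sum_(j < k) p ^+ j * \sum_t c (j, t) *: b t.
  transitivity (\sum_(j < k) \sum_t c (j, t) *: (p ^+ j * b t)).
    by rewrite pair_bigA /=; apply: eq_bigr => -[].
  apply: eq_bigr => j _; rewrite mulr_sumr; apply: eq_bigr => t _.
  by rewrite scalerAr.
elim: k c => [|k IH] c; first by move=> _ [[]].
rewrite big_ord_recl expr0 mul1r.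
under [X in _ + X]eq_bigr do rewrite lift0 exprS -mulrA.
rewrite -[X in _ + X]mulr_sumr => h.
have c0 t : c (ord0, t) = 0.
  apply: (indb (fun t => c (ord0, t))).
  have := ID _ _ (JI _ h)
    (IM (- \sum_(j < k) p ^+ j * \sum_t c (lift ord0 j, t) *: b t) _ Ip).
  by rewrite mulNr mulrC addrK.
move: h; rewrite big1 ?add0r; last by move=> t _; rewrite c0 scale0r.
move=> /pJ /(IH (fun u => c (lift ord0 u.1, u.2))) h [j t].
have [j' ->|->] := unliftP ord0 j; last exact: c0.
exact: (h (j', t)).
Qed.

(* The b_i are the products f_0^a_0 ... f_(k-1)^a_(k-1) with exponents below t. *)
Lemma independent_mod_box (Q : nat -> set {mpoly K[n]})
    (f : nat -> {mpoly K[n]}) k e t :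
  (forall i, ideal_set (Q i)) -> (forall i, (i < k)%N -> Q i.+1 `<=` Q i) ->
  ~ Q 0%N 1 ->
  (forall i, (i < k)%N -> [/\ Q i (f i), (msize (f i) <= e.+1)%N &
    forall q, Q i.+1 (f i * q) -> Q i.+1 q]) ->
  exists (T : finType) (b : T -> {mpoly K[n]}), [/\ #|T| = (t ^ k)%N,
    forall i, (msize (b i) <= (k * (t * e)).+1)%N & independent_mod (Q k) b].
Proof.
move=> idQ Qsub Q1; elim: k Qsub => [|k IH] Qsub hf.
  exists unit, (fun=> 1); split; first by rewrite card_unit.
    by move=> _; rewrite msize1.
  move=> c; rewrite (bigD1 tt) //= big1 ?addr0 => [|[]] //.
  move=> Qc [] ; apply/eqP/negPn/negP => c0; apply: Q1.
  have := ideal_scale (c tt)^-1 (idQ _) Qc.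
  by rewrite scalerA mulVf // scale1r.
have [|i ik|T [b [cT sb indb]]] := IH.
- by move=> i ik; apply: Qsub; rewrite ltnW.
- by apply: hf; rewrite ltnW.
have [Qf sf Qp] := hf k (ltnSn k).
exists ('I_t * T)%type, (fun u : 'I_t * T => f k ^+ u.1 * b u.2); split.
- by rewrite card_prod card_ord cT expnS.
- move=> [j i] /=; rewrite mulSn; apply: msize_mul_le => //.
  apply: leq_trans (msize_exp_le j sf) _.
  by rewrite ltnS leq_mul2r ltnW ?orbT.
- apply: independent_mod_powers indb => //; first exact: Qsub.
  by case: (idQ k.+1).
Qed.

(** The bound counts the coefficients of all the [g u]. With more elements than that, a nontrivial
    combination has all these coefficients zero and so lies in [I]. *)
Lemma independent_mod_card I m (y : m.-tuple {mpoly K[n]}) B D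
    (T : finType) (b : T -> {mpoly K[n]}) :
  ideal_set I -> independent_mod I b -> (forall i, spanned I y B D (b i)) ->
  (#|T| <= D.+1 ^ m * #|{: 'X_{1..n < B}}|)%N.
Proof.
move=> idI indb /choice[g hg]; rewrite leqNgt; apply/negP => lt.
pose A (i : T) (u : 'X_{1..m < D.+1} * 'X_{1..n < B}) := (g i u.2)@_u.1.
have [|c [[i ci0] hc]] := @homogeneous_system_solution K _ _ A.
  apply: leq_ltn_trans lt; rewrite card_prod leq_mul2r card_bmultinom_le.
  by rewrite orbT.
apply/negP: ci0; rewrite negbK; apply/eqP; apply: (indb c).
rewrite [X in I X](_ : _ =
    \sum_i c i *: (b i - \sum_u (g i u \mPo y) * 'X_[u])).
  by apply: ideal_sum => // j _; apply: ideal_scale => //; case: (hg j).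
under [RHS]eq_bigr do rewrite scalerBr.
rewrite sumrB [X in _ = _ - X](_ : _ = 0) ?subr0 //.
under eq_bigr do rewrite scaler_sumr; rewrite exchange_big big1 //= => u _.
under eq_bigr do rewrite scalerAl -comp_mpolyZ.
rewrite -mulr_suml -linear_sum /= [X in X \mPo y](_ : _ = 0).
  by rewrite comp_mpoly0 mul0r.
apply/mpolyP => a; rewrite mcoeff0 linear_sum /=.
under eq_bigr do rewrite mcoeffZ.
have [aD|aD] := ltnP (mdeg a) D.+1; first exact: (hc (BMultinom aD, u)).
rewrite big1 // => j _; rewrite memN_msupp_eq0 ?mulr0 //.
by apply: msize_mdeg_ge; apply: leq_trans aD; case: (hg j).
Qed.

End Counting.

Lemma leq_of_expn_bound k m C : (forall t, t ^ k <= C * t ^ m)%N -> (k <= m)%N.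
Proof.
move=> h; rewrite leqNgt; apply/negP => mk.
(* If m < k, then t = C + 1 gives t^k >= t^(m+1) > C t^m. *)
have := h C.+1; rewrite -(subnK mk) addnS -addSn expnD leq_pmul2r ?expn_gt0 //.
by rewrite expnS leqNgt leq_pmulr // expn_gt0.
Qed.

(** * Chains of irreducible closed sets *)

Section ProjectiveDimension.
Context {K : numClosedFieldType} {n : nat}.
Implicit Types (Z X : set (projspace K n)) (p q : {mpoly K[n]}).

(** Since [vanishes_at] tests all homogeneous coordinates of a point, this is the homogeneous ideal
    of [Z] even though [p] is arbitrary. *)
Definition cone_ideal Z : set {mpoly K[n]} :=
  [set p | forall P, Z P -> vanishes_at p P].

Lemma cone_ideal_ideal Z : ideal_set (cone_ideal Z).
Proof.
split=> [P _ x _|p q hp hq P ZP x Px|p q hq P ZP x Px]; first exact: meval0.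
- by rewrite mevalD (hp P) // (hq P) // addr0.
- by rewrite mevalM (hq P) // mulr0.
Qed.

Lemma hcoord_scale (P : projspace K n) x c :
  hcoord P x -> c != 0 -> hcoord P (c *: x).
Proof.
move=> [x0 e] c0; split; first by rewrite scaler_eq0 negb_or c0.
apply/eqP; rewrite e eqEsubv -!memvE memvZ ?memv_line // andbT.
by rewrite -[x in x \in _](scalerK c0) memvZ // memv_line.
Qed.

Lemma hcoord_line (P : projspace K n) x x' :
  hcoord P x -> hcoord P x' -> exists2 c, c != 0 & x' = c *: x.
Proof.
move=> [x0 e] [x'0 e'].
have : x' \in <[x]>%VS by rewrite -e e' memv_line.
case/vlineP=> c ec; exists c => //.
by apply: contraNneq x'0 => c0; rewrite ec c0 scale0r.
Qed.

Lemma vanishes_at_homog (P : projspace K n) p x : p \is homog mdeg ->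
  hcoord P x -> p.@[x 0] = 0 -> vanishes_at p P.
Proof.
case/homogP=> d hp Px px x' /(hcoord_line Px)[c c0 ->].
by rewrite (meval_dhomog_scale _ _ hp) px mulr0.
Qed.

Lemma vanishes_at_pihomog (P : projspace K n) p d :
  vanishes_at p P -> vanishes_at (pihomog mdeg d p) P.
Proof.
move=> pP x Px; apply: meval_cone_pihomog => c c0.
by apply: pP; apply: hcoord_scale.
Qed.

Lemma cone_ideal_pihomog Z p d :
  cone_ideal Z p -> cone_ideal Z (pihomog mdeg d p).
Proof. by move=> h P ZP; apply/vanishes_at_pihomog/h. Qed.

Lemma vanishes_at_closed p : zariski_closed [set P | @vanishes_at K n p P].
Proof.
exists [set q | exists d, q = pihomog mdeg d p]; split.
  by move=> _ [d ->]; apply/homogP; exists d; exact: pihomogP.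
apply/seteqP; split=> P /= h.
  by move=> _ [d ->]; apply: vanishes_at_pihomog.
move=> x Px; rewrite (pihomog_partitionE (leqnn (msize p))) raddf_sum big1 //=.
by move=> d _; apply: (h _ _ x Px); exists d.
Qed.

(** [Z] is covered by the zero loci of [p] and [q], hence contained in one of them. Homogeneity of
    [p] makes its vanishing independent of the representative. *)
Lemma cone_ideal_cancel Z p q : irreducible_closed Z -> p \is homog mdeg ->
  ~ cone_ideal Z p -> cone_ideal Z (p * q) -> cone_ideal Z q.
Proof.
move=> [_ _ irr] hp Zp Zpq.
have [] := irr _ _ (vanishes_at_closed p) (vanishes_at_closed q).
- move=> P ZP; have [Pp|/existsNP[x]] := pselect (vanishes_at p P).
    by left.
  move=> /not_implyP[Px px]; right=> x' Px'.
  have := Zpq P ZP x' Px'; rewrite mevalM => /eqP; rewrite mulf_eq0.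
  case/orP=> /eqP // px'; case: px.
  exact: (vanishes_at_homog hp Px').
- by move=> h; case: Zp.
- by [].
Qed.

Lemma ideal_origin : ideal_set [set p : {mpoly K[n]} | p.@[fun=> 0] = 0].
Proof.
split=> [|p q|p q] /=; first exact: meval0.
- by rewrite mevalD => -> ->; rewrite addr0.
- by rewrite mevalM => ->; rewrite mulr0.
Qed.

Lemma projspace_of (x : 'rV[K]_n) : x != 0 ->
  exists P : projspace K n, hcoord P x.
Proof.
move=> x0; have d1 : \dim <[x]>%VS == 1%N by rewrite dim_vline x0.
by exists (exist _ <[x]>%VS d1).
Qed.

Lemma projspace_coord (P : projspace K n) : exists x, hcoord P x.
Proof.
have /eqP d1 := svalP P; exists (vpick (sval P)).
have x0 : vpick (sval P) != 0.
  by rewrite vpick0; apply/eqP => e; move: d1; rewrite e dimv0.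
split=> //; apply/eqP; rewrite eq_sym eqEdim d1 dim_vline x0 andbT.
by rewrite -memvE memv_pick.
Qed.

Lemma chain_length_lt (X : set (projspace K n)) k m
    (y : m.-tuple {mpoly K[n]}) :
  large_fibres K -> chain_of_length X k ->
  (forall j, tnth y j \is 1.-homog) ->
  (forall P x, X P -> hcoord P x -> ~ forall j, (tnth y j).@[x 0] = 0) ->
  (k < m)%N.
Proof.
move=> Kl [Z [Zirr Zlt]] y1 yX.
have Zi i (ik : (i <= k)%N) : irreducible_closed (Z i) by case: (Zirr i ik).
have idZ := cone_ideal_ideal (Z k).
have [|B hB] := @finite_spanning K n m (cone_ideal (Z k)) y idZ
   (fun d p => @cone_ideal_pihomog (Z k) p d) y1.
  (* The only common zero of the ideal of Z_k and the y_j is the origin: any other would give a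
     point of [X] at which all y_j vanish. *)
  move=> i; apply: nullstellensatz => //; first exact: ideal_add_ideal.
  move=> a ha; pose x := \row_i a i.
  have ex : a =1 x 0 by move=> j; rewrite mxE.
  have [x0|x0] := eqVneq x 0; first by rewrite mevalXU ex x0 mxE.
  have [P Px] := projspace_of x0.
  have [[S [Shom ZS]] _ _] := Zi k (leqnn k).
  have ZP : Z k P.
    rewrite ZS => p Sp; apply: (vanishes_at_homog (Shom p Sp) Px).
    rewrite -(meval_eq _ ex); apply: ha; exists p, (fun=> 0); split.
      by move=> P'; rewrite ZS => /(_ p Sp).
    by rewrite big1 ?addr0 // => j _; rewrite mul0r.
  case: (yX P x) => //; first by case: (Zirr k (leqnn k)) => _; apply.
  move=> j; rewrite -(meval_eq _ ex); apply: ha.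
  exists 0, (fun j' => (j' == j)%:R); split; first by case: idZ.
  rewrite add0r (bigD1 j) //= eqxx mul1r big1 ?addr0 // => j' /negbTE->.
  by rewrite mul0r.
(* The ideals of the cones over the chain, preceded by the ideal of the origin. This extra term
   yields k + 1 factors and the strict inequality. *)
pose Q i := if i is i'.+1 then cone_ideal (Z i')
  else [set p : {mpoly K[n]} | p.@[fun=> 0] = 0].
have idQ i : ideal_set (Q i).
  by case: i => [|i]; [exact: ideal_origin | exact: cone_ideal_ideal].
have Qsub i : (i < k.+1)%N -> Q i.+1 `<=` Q i.
  case: i => [|i] ik p /= hp; last first.
    by move=> P /(proj1 (Zlt i ik)); apply: hp.
  have [_ [P ZP] _] := Zi 0%N isT; have [x Px] := projspace_coord P.
  rewrite (meval_eq (v2 := (0 *: x) 0)); last by move=> j; rewrite scale0r mxE.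
  rewrite meval_scale big1 // => d _.
  by rewrite (cone_ideal_pihomog d hp ZP Px) mulr0.
(* For i = 0 a coordinate that is nonzero at a point of Z_0; afterwards one of the forms cutting out
   the previous set, nonzero at a point of the next. *)
have /choice[f hf] i : exists f, (i < k.+1)%N -> [/\ Q i f, f \is homog mdeg &
    forall q, Q i.+1 (f * q) -> Q i.+1 q].
  have [ik|] := ltnP i k.+1; last by exists 0.
  suff [f [Qf hf Zf]] : exists f, [/\ Q i f, f \is homog mdeg &
      ~ cone_ideal (Z i) f].
    by exists f => _; split=> // q; apply: cone_ideal_cancel => //; apply: Zi.
  case: i ik => [|i] ik.
    have [_ [P ZP] _] := Zi 0%N isT; have [x Px] := projspace_coord P.
    have [/rV0Pn[j xj] _] := Px.
    exists 'X_j; split; first by rewrite /= mevalXU.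
      by apply/homogP; exists 1%N; rewrite dhomogX /= mdeg1.
    by move=> /(_ P ZP x Px); rewrite mevalXU; apply/eqP.
  have [_ /existsNP[P /not_implyP[ZP]]] := Zlt i ik.
  have [[S [Shom ZS]] _ _] := Zi i (ltnW ik).
  rewrite {1}ZS => /existsNP[p /not_implyP[Sp pP]].
  exists p; split; [by move=> P'; rewrite ZS => /(_ p Sp)|exact: Shom|].
  by move=> /(_ P ZP).
pose e := (\max_(i < k.+1) msize (f i))%N.
have fe i : (i < k.+1)%N -> (msize (f i) <= e.+1)%N.
  move=> ik; apply: leqW; exact: (leq_bigmax (Ordinal ik)).
(* The products have degree at most D = (k+1) t e, and D + 1 <= ((k+1) e + 1) t for t >= 1. *)
apply: (@leq_of_expn_bound _ _
  ((k.+1 * e).+1 ^ m * #|{: 'X_{1..n < B}}|)) => t.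
have [->|t0] := posnP t; first by rewrite exp0n.
have [|i ik|T [b [<- sb indb]]] :=
  @independent_mod_box K n Q f k.+1 e t idQ Qsub.
- by rewrite /= meval1 => /eqP; rewrite oner_eq0.
- by have [? ? ?] := hf i ik; split=> //; exact: fe.
have := independent_mod_card idZ indb (fun i => hB _ _ (sb i)).
move/leq_trans; apply; rewrite mulnAC -expnMn leq_mul2r.
have [->|m0] := posnP m; first by rewrite orbT.
apply/orP; right.
by rewrite leq_exp2r // mulnCA [X in (_ <= X)%N]mulnC mulnS -add1n leq_add2r.
Qed.

End ProjectiveDimension.

(** * Kernel coordinates and derivatives of powers of linear forms *)

Lemma kernel_coordinates (K : fieldType) rho r (A : 'M[K]_(rho, r)) :
  row_free A ->
  exists f : 'I_(r - rho) -> 'I_r, forall v : 'cV_r, A *m v = 0 ->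
    (forall i, v (f i) 0 = 0) -> v = 0.
Proof.
(* The columns of [N] span the kernel of [A]. [maxrankfun] picks rows of [N] that span its row
   space, so an element N w of the kernel is determined by its entries there. *)
move=> /eqP rA; pose N := (kermx A^T)^T.
have rN : \rank N = (r - rho)%N by rewrite mxrank_tr mxrank_ker mxrank_tr rA.
suff [f hf] : exists f : 'I_(\rank N) -> 'I_r, forall v : 'cV_r, A *m v = 0 ->
    (forall i, v (f i) 0 = 0) -> v = 0.
  by move: f hf; rewrite rN => f hf; exists f.
exists (maxrankfun N) => v Av vf.
have /submxP[w ew] : (v^T <= kermx A^T)%MS.
  by apply/sub_kermxP; rewrite -trmx_mul Av trmx0.
have ev : v = N *m w^T by rewrite -trmx_mul -ew trmxK.
have /submxP[M eM] : (N <= rowsub (maxrankfun N) N)%MS by rewrite eq_maxrowsub.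
rewrite ev eM -mulmxA mul_rowsub_mx -ev [rowsub _ _](_ : _ = 0) ?mulmx0 //.
by apply/matrixP => i j; rewrite !mxE ord1 vf.
Qed.

Section PowersOfLinearForms.
Context {K : fieldType} {n : nat}.
Implicit Types (v x : 'rV[K]_n) (p : {mpoly K[n]}).

Lemma meval_linform v x : (linform v).@[x 0] = \sum_i v 0 i * x 0 i.
Proof.
rewrite /linform raddf_sum /=; apply: eq_bigr => i _.
by rewrite mevalZ mevalXU.
Qed.

Lemma meval_linformC v x : (linform v).@[x 0] = (linform x).@[v 0].
Proof. by rewrite !meval_linform; apply: eq_bigr => i _; rewrite mulrC. Qed.

Lemma linform_homog v : linform v \is 1.-homog.
Proof.
by apply: rpred_sum => i _; apply: rpredZ; rewrite dhomogX /= mdeg1.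
Qed.

Lemma mderiv_linform v i : (linform v)^`M(i) = (v 0 i)%:MP.
Proof.
rewrite /linform linear_sum (bigD1 i) //= big1 ?addr0 => [|j ne].
  rewrite mderivZ mderivX mnm1E eqxx -[X in (X - _)%MM]add0m addmK scale1r.
  by rewrite mpolyX0 -mul_mpolyC mulr1.
by rewrite mderivZ mderivX mnm1E (negbTE ne) scale0r scaler0.
Qed.

Lemma mderiv_linform_exp v i d :
  (linform v ^+ d)^`M(i) = (d%:R * v 0 i) *: linform v ^+ d.-1.
Proof.
elim: d => [|d IH]; first by rewrite expr0 -mpolyC1 mderivC mul0r scale0r.
rewrite exprS mderivM mderiv_linform IH -scalerAr mul_mpolyC.
case: d {IH} => [|d] /=; first by rewrite !mul0r scale0r addr0 mul1r.
by rewrite -exprS -scalerDl -[d.+2]addn1 addnC natrD mulrDl mul1r.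
Qed.

Lemma mderivm_linform_exp v (m : 'X_{1..n}) (d : nat) :
  (linform v ^+ d)^`M[m] =
  ((d ^_ mdeg m)%:R * ('X_[m] : {mpoly K[n]}).@[v 0])
    *: linform v ^+ (d - mdeg m).
Proof.
move e : (mdeg m) => k; elim: k m e => [|k IH] m e.
  have /eqP -> : m == 0%MM by rewrite -mdeg_eq0 e.
  by rewrite mderivm0m mpolyX0 meval1 mul1r scale1r subn0.
have [i mi] : exists i, m i != 0%N.
  apply: contrapT => /forallNP h.
  by move: e; rewrite mdegE big1 // => i _; apply/eqP/negPn/negP/h.
have le : (U_(i) <= m)%MM by rewrite lep1mP.
have em := submK le; have ek : mdeg (m - U_(i)) = k.
  by move: e; rewrite -{1}em mdegD mdeg1 addn1 => -[].
rewrite -em mderivmDm (IH _ ek) linearZ /= mderivmU1m mderiv_linform_exp.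
rewrite scalerA -subnS mpolyXD mevalM mevalXU ffactnSr natrM.
by congr (_ *: _); ring.
Qed.

Lemma contract_linform_exp v p (s d : nat) : p \is s.-homog ->
  Defs.contract (linform v ^+ d) p =
  ((d ^_ s)%:R * p.@[v 0]) *: linform v ^+ (d - s).
Proof.
move=> hp; rewrite /Defs.contract mevalE mulr_sumr scaler_suml big_seq.
rewrite [RHS]big_seq; apply: eq_bigr => m mp.
have /= em := dhomog_mf hp mp.
by rewrite mderivm_linform_exp em mevalX scalerA mulrCA.
Qed.

Lemma contract_sum_linform_exp r (l : 'I_r -> 'rV[K]_n) p (s d : nat) :
  p \is s.-homog ->
  Defs.contract (\sum_j linform (l j) ^+ d) p =
  (d ^_ s)%:R *: \sum_j p.@[l j 0] *: linform (l j) ^+ (d - s).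
Proof.
move=> hp.
have -> : Defs.contract (\sum_j linform (l j) ^+ d) p =
    \sum_j Defs.contract (linform (l j) ^+ d) p.
  rewrite /Defs.contract exchange_big; apply: eq_bigr => m _ /=.
  by rewrite linear_sum scaler_sumr.
rewrite scaler_sumr; apply: eq_bigr => j _.
by rewrite (contract_linform_exp _ _ hp) scalerA.
Qed.

End PowersOfLinearForms.

(** * Power sum decompositions, the flattening and the singular locus *)

Section Decomposition.
Context {K : numClosedFieldType} {n d s r : nat}.
Variables (phi : SymPow K n d) (l : 'I_r -> 'rV[K]_n).
Hypotheses (sd : (s <= d)%N)
  (phi_span : form_span phi = [set: 'rV[K]_n])
  (phiE : (phi : {mpoly K[n]}) = \sum_(j < r) linform (l j) ^+ d).

(** Thus the flattening factors through evaluation at the [l j], which bounds its rank. *)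
Lemma flattening_eq0 (p : SymPow K n s) :
  (forall j, (p : {mpoly K[n]}).@[l j 0] = 0) -> flattening phi s p = 0.
Proof.
move=> h; rewrite lfunE; apply: form_poly_inj.
rewrite linearZ /form_poly /= -/(form_poly p) -/(form_poly phi) phiE.
rewrite (contract_sum_linform_exp _ _ (SymPow_homog p)) big1 ?scaler0 //.
by move=> j _; rewrite h scale0r.
Qed.

Lemma dirderiv_eq0 (x : 'rV[K]_n) : dirderiv x phi = 0 -> x = 0.
Proof.
move=> h; apply/rowP => i.
have : form_span phi (delta_mx 0 i) by rewrite phi_span.
move/(_ x h); rewrite (bigD1 i) //= big1 ?addr0 => [|j ne].
  by rewrite !mxE !eqxx mulr1.
by rewrite mxE (negbTE ne) andbF mulr0.
Qed.

(** Every term of the derivative of [phi] along [x] carries a factor <l_j, x>. *)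
Lemma span_points (x : 'rV[K]_n) :
  (forall j, (linform (l j)).@[x 0] = 0) -> x = 0.
Proof.
move=> h; apply: dirderiv_eq0; rewrite -[X in dirderiv x X]contract1.
rewrite -contract_linform mulr1 phiE.
rewrite (contract_sum_linform_exp _ _ (linform_homog x)) big1 ?scaler0 //.
by move=> j _; rewrite -meval_linformC h scale0r.
Qed.

Lemma Sigma_contract P x (p : {mpoly K[n]}) :
  Sigma s phi P -> hcoord P x -> p \is s.-homog ->
  (Defs.contract phi p).@[x 0] = 0.
Proof.
move=> [_ h] Px hp; rewrite /Defs.contract raddf_sum big_seq big1 //= => m mp.
have /= em := dhomog_mf hp mp.
by rewrite mevalZ (h m _ x Px) ?em // mulr0.
Qed.

Lemma Sigma_relation P x (p : {mpoly K[n]}) :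
  Sigma s phi P -> hcoord P x -> p \is s.-homog ->
  \sum_j p.@[l j 0] * (linform (l j)).@[x 0] ^+ (d - s) = 0.
Proof.
move=> SP Px hp; have := Sigma_contract SP Px hp.
rewrite phiE (contract_sum_linform_exp _ _ hp) mevalZ => /eqP.
rewrite mulf_eq0 pnatr_eq0 eqn0Ngt ffact_gt0 sd /= => /eqP {2}<-.
rewrite raddf_sum /=; apply: eq_bigr => j _.
by rewrite mevalZ rmorphXn.
Qed.

(** Derivatives of order [d] are the coefficients of [phi] up to nonzero factors, so s = d would
    force [phi] = 0, against [phi_span]. This keeps the exponent d - s positive. *)
Lemma Sigma_ltn_degree P : Sigma s phi P -> s != d.
Proof.
move=> SP; apply/eqP => e; have [x Px] := projspace_coord P.
have phi0 : (phi : {mpoly K[n]}) = 0.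
  apply/mpolyP => m; rewrite mcoeff0.
  have [em|/eqP em] := mdeg m =P d; last first.
    exact: dhomog_nemf_coeff (SymPow_homog phi) em.
  have hX : ('X_[m] : {mpoly K[n]}) \is s.-homog by rewrite dhomogX /= em e.
  have := Sigma_contract SP Px hX.
  have := contract_homog hX (SymPow_homog phi).
  rewrite contractX e subnn => /dhomog_msize_le/msize1_polyC ->.
  rewrite mevalC mcoeff_mderivm addm0 => /eqP.
  rewrite mulrn_eq0 => /orP[|/eqP //].
  by rewrite -leqn0 leqNgt prodn_gt0 // => i; rewrite ffactnn fact_gt0.
have [/negP[]] := Px; apply/eqP/dirderiv_eq0.
by rewrite phi0 linear0.
Qed.

(** The first conjunct serves an empty Sigma_s(phi), which has no chains. *)
Lemma rank_add_chain_length_lt :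
  (\dim (limg (flattening phi s)) <= r)%N /\
  forall k, large_fibres K -> chain_of_length (Sigma s phi) k ->
    (\dim (limg (flattening phi s)) + k < r)%N.
Proof.
pose F := flattening phi s; pose rho := \dim (limg F).
have /choice[p hp] (i : 'I_rho) :
    exists p : SymPow K n s, F p = (vbasis (limg F))`_i.
  have /memv_imgP[p _ ->] : (vbasis (limg F))`_i \in limg F.
    by apply/vbasis_mem/mem_nth; rewrite size_tuple.
  by exists p.
(* The rows are the evaluation vectors of preimages of a basis of the image. A relation between them
   would give one in the basis by [flattening_eq0]. *)
pose A := \matrix_(i < rho, j < r) (p i : {mpoly K[n]}).@[l j 0].
have fA : row_free A.
  rewrite -kermx_eq0; apply/rowV0P => u /sub_kermxP uA.
  have /freeP fb := basis_free (vbasisP (limg F)).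
  apply/rowP => i; rewrite mxE; apply: (fb (fun i => u 0 i)).
  rewrite -[RHS](@flattening_eq0 (\sum_i u 0 i *: p i)).
    by rewrite linear_sum; apply: eq_bigr => j _; rewrite linearZ /= hp.
  move=> j; rewrite !linear_sum /=.
  have /rowP/(_ j) := uA; rewrite !mxE => e; rewrite -[RHS]e.
by apply: eq_bigr => t _; rewrite linearZ /= mxE.
have rho_r : (rho <= r)%N.
  by move/eqP: fA => <-; apply: rank_leq_col.
split=> // k Kl ch; rewrite -/F -/rho -ltn_subRL.
have [f hf] := kernel_coordinates fA.
pose y := [tuple linform (l (f j)) | j < r - rho].
apply: (@chain_length_lt K n (Sigma s phi) k _ y) => //.
  by move=> j; rewrite tnth_mktuple; apply: linform_homog.
move=> P x SP Px yx; have [/eqP x0 _] := Px; apply: x0; apply: span_points.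
(* Needed in both directions: a zero power must have a zero base, and 0 to the power d - s must be
   0. *)
have ds : (0 < d - s)%N.
  by rewrite subn_gt0 ltn_neqAle sd andbT; apply: Sigma_ltn_degree SP.
pose v := \col_j (linform (l j)).@[x 0] ^+ (d - s).
suff v0 : v = 0.
  move=> j; have /colP/(_ j) := v0; rewrite !mxE => /eqP.
  by rewrite expf_eq0 ds => /eqP.
apply: hf => [|i].
  apply/colP => i; rewrite !mxE.
  rewrite -[RHS](Sigma_relation SP Px (SymPow_homog (p i))).
  by apply: eq_bigr => j _; rewrite !mxE.
by have := yx i; rewrite mxE tnth_mktuple => ->; rewrite expr0n eqn0Ngt ds.
Qed.

End Decomposition.

End Lemmas.

Theorem theorem1p3 (R : realType) (n d s : nat) (phi : SymPow R[i] n d) :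
  (1 <= s <= d)%N ->
  form_span phi = [set: 'rV[R[i]]_n] ->
  ((\dim (limg (flattening phi s)))%:R%:E + proj_dim (Sigma s phi) + 1%:E
     <= waring_rank phi)%E.
Proof.
move=> /andP[_ sd] hspan; apply: le_ereal_inf_tmp => _ [r [l phiE] <-].
have H := rank_add_chain_length_lt sd hspan phiE.
set rho := \dim _ in H *.
suff : (proj_dim (Sigma s phi) <= (r%:R - rho%:R - 1)%R%:E)%E.
  move=> h; apply: (@le_trans _ _
    (rho%:R%:E + (r%:R - rho%:R - 1)%R%:E + 1%:E)%E).
    by rewrite leeD2r // leeD2l.
  by rewrite -!EFinD lee_fin; lra.
(* For an empty locus, of dimension -1, the claim is rho <= r; otherwise every chain length k
   satisfies rho + k < r. *)
rewrite /proj_dim; case: asboolP => _.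
  by rewrite lee_fin; have := H.1; rewrite -(ler_nat R); lra.
apply: ge_ereal_sup => _ [k ch <-]; rewrite lee_fin.
have := H.2 k (@large_fibres_complex R) ch.
by rewrite -(ler_nat R) -addn1 !natrD; lra.
Qed.
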